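(* Let $(\Omega,d)$ be a separable metric space and let $\operatorname{diam}(\Omega)=\sup\{d(x,y):x,y\in\Omega\}$. For all Borel probability measures $\mu,\nu$ on $\Omega$, the Wasserstein metric $d_W$ and the Prokhorov metric $d_P$ satisfy $$\bigl(d_P(\mu,\nu)\bigr)^2\le d_W(\mu,\nu)\le(\operatorname{diam}(\Omega)+1)\,d_P(\mu,\nu).$$
   Context: A metric space is regarded as a measurable space with its Borel $\sigma$-algebra. The Prokhorov metric is $d_P(\mu,\nu)=\inf\{\epsilon>0:\mu(B)\le\nu(B^{\epsilon})+\epsilon\text{ for all Borel sets }B\subseteq\Omega\}$, where $B^{\epsilon}=\{x:\inf_{y\in B}d(x,y)\le\epsilon\}$ (with $\emptyset^\epsilon=\emptyset$). The Wasserstein (Kantorovich) metric is $d_W(\mu,\nu)=\inf_J \mathbf{E}_J[d(X,Y)]$, the infimum being over all joint distributions $J$ of pairs $(X,Y)$ of $\Omega$-valued random variables with marginal laws $\mu$ (of $X$) and $\nu$ (of $Y$). By the Kantorovich–Rubinstein theorem this equals $\sup\{|\int h\,d\mu-\int h\,d\nu|:|h(x)-h(y)|\le d(x,y)\ \forall x,y\in\Omega\}$, the paper's equivalent definition. If $\operatorname{diam}(\Omega)=\infty$, the right-hand inequality carries no information (its right side is read as $\infty$). *)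

(* Defs.v *)
From HB Require Import structures.
From mathcomp Require Import all_boot all_order all_algebra.
From mathcomp Require Import all_classical all_reals all_analysis.

Set Implicit Arguments.
Unset Strict Implicit.
Unset Printing Implicit Defensive.

Import Order.TTheory GRing.Theory Num.Theory.

Local Open Scope classical_set_scope.
Local Open Scope ring_scope.

(* Measurable types are pointed in MathComp-Analysis, so the metric space has
   to be pointed as well. This only excludes the empty space, which carries no
   probability measure; no definition below refers to the point. *)
#[short(type="pointedMetricType")]
HB.structure Definition PointedMetric (K : numDomainType) :=
  { M of Metric K M & isPointed M }.

Definition separable (T : topologicalType) : Prop :=
  exists2 S : set T, countable S & dense S.

Notation borel T := (g_sigma_algebraType (@open T)).

Section ProbabilityMetrics.
Context {R : realType} {Omega : pointedMetricType R}.
Local Open Scope ereal_scope.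

(* B^eps. The infimum is taken in \bar R, where the infimum of the empty set
   is +oo, so that the thickening of the empty set is empty. *)
Definition thickening (eps : R) (B : set Omega) : set Omega :=
  [set x | ereal_inf [set (mdist x y)%:E | y in B] <= eps%:E].

Definition prokhorov (mu nu : probability (borel Omega) R) : \bar R :=
  ereal_inf [set eps%:E | eps in [set eps : R | (0 < eps)%R /\
    forall B : set (borel Omega), measurable B ->
      mu B <= nu (thickening eps B) + eps%:E]].

(* Joint laws live on the product sigma-algebra of Omega * Omega; for a
   separable Omega it is the Borel sigma-algebra of the product space. *)
Definition coupling (mu nu : probability (borel Omega) R) :
    set (probability (borel Omega * borel Omega)%type R) :=
  [set J | forall A : set (borel Omega), measurable A ->
    pushforward J fst A = mu A /\ pushforward J snd A = nu A].

Definition wasserstein (mu nu : probability (borel Omega) R) : \bar R :=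
  ereal_inf [set 'E_J [ (fun w : borel Omega * borel Omega =>
                          mdist (w.1 : Omega) (w.2 : Omega)) ]
            | J in coupling mu nu].

End ProbabilityMetrics.

Definition diam {R : realType} (Omega : pointedMetricType R) : \bar R :=
  ereal_sup [set (mdist p.1 p.2)%:E | p in [set: Omega * Omega]].

(* Main.v *)
Require Import Defs.
From HB Require Import structures.
From mathcomp Require Import all_boot all_order all_algebra.
From mathcomp Require Import all_classical all_reals all_analysis.
From mathcomp Require Import measurable_realfun lra.

(** The lower bound is Markov's inequality: if a coupling [J] of [mu] and [nu]
    has mean distance at most [eps ^+ 2], then two coordinates are at distance
    at least [eps] with probability at most [eps], so that every Borel set [B]
    satisfies [mu B <= nu (thickening eps B) + eps]. Separability enters through
    the measurability of the distance for the product sigma-algebra.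

    The upper bound is an approximate form of Strassen's theorem
    ([strassen]): if [eps] is admissible in the definition of the Prokhorov
    metric then, for every [r > 0], some coupling keeps the coordinates within
    distance [eps + 5 * r] outside an event of probability at most
    [eps + 2 * r]. Bounding the distance by [diam Omega] on that event
    ([expectation_le_far]) and letting [r] tend to [0] gives the inequality.

    To build the coupling, [Omega] is cut into finitely many cells of diameter
    less than [2 * r] and a remainder of mass at most [r] for both laws. Two
    cells other than the remainder are adjacent when they contain points at
    distance less than [eps + r]. Applied to unions of cells, the Prokhorov
    condition becomes a Hall condition with deficiency between the weights of
    the cells. A weighted version of Hall's marriage theorem ([hall_transport],
    proved by the Halmos-Vaughan induction) yields a transport plan between the
    cells that is supported on adjacent cells up to mass [eps + 2 * r]
    ([finite_strassen]). Finally, a plan between cells is realized by a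
    probability on the product space whose density with respect to [mu \x nu]
    is constant on each product of two cells ([coupling_of_cells]). *)

Set Implicit Arguments.
Unset Strict Implicit.
Unset Printing Implicit Defensive.

Import Order.TTheory GRing.Theory Num.Theory.
Import numFieldNormedType.Exports.

Local Open Scope ring_scope.

(** * Weighted Hall theorem *)

Section Hall.
Context (I J : finType) (e : I -> J -> bool).
Implicit Types (S T : {set I}).

(** The columns adjacent to some row of [S], for the adjacency relation [e]
    between rows and columns. *)
Definition neighbours S : {set J} := [set j | [exists i in S, e i j]].

Lemma neighboursP S j :
  reflect (exists2 i, i \in S & e i j) (j \in neighbours S).
Proof. by rewrite inE; exact: exists_inP. Qed.

Lemma neighboursS S T : S \subset T -> neighbours S \subset neighbours T.
Proof.
move=> ST; apply/fintype.subsetP => j /neighboursP[i iS eij].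
by apply/neighboursP; exists i => //; exact: (fintype.subsetP ST).
Qed.

Lemma neighboursU S T : neighbours (S :|: T) = neighbours S :|: neighbours T.
Proof.
apply/setP => j; rewrite finset.in_setU; apply/neighboursP/orP.
- by case=> i /finset.setUP[]iS eij; [left|right]; apply/neighboursP; exists i.
- case=> /neighboursP[i iS eij]; exists i => //.
    by rewrite finset.in_setU iS.
  by rewrite finset.in_setU iS orbT.
Qed.

Section RealWeights.
Context {R : realFieldType}.
Implicit Types (a : I -> R) (b : J -> R).

Let mass (K : finType) (c : K -> R) (A : {set K}) := \sum_(k in A) c k.

Let massU (K : finType) (c : K -> R) (A B : {set K}) :
  mass c (A :|: B) = mass c A + mass c (B :\: A).
Proof.
rewrite /mass (big_setID A)/=; congr (_ + _); apply: eq_bigl => k; rewrite !inE.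
  by case: (k \in A); rewrite //= andbF.
by case: (k \in A).
Qed.

Let massS (K : finType) (c : K -> R) (A B : {set K}) :
  (forall k, 0 <= c k) -> A \subset B -> mass c A <= mass c B.
Proof.
move=> c0 AB; rewrite /mass [leRHS](big_setID A)/= (finset.setIidPr AB) lerDl.
exact: sumr_ge0.
Qed.

Let mass_restr (K : finType) (c : K -> R) (A B : {set K}) :
  mass (fun k => if k \in B then c k else 0) A = mass c (A :&: B).
Proof.
rewrite /mass -big_mkcondr; apply: eq_bigl => k.
by rewrite finset.in_setI.
Qed.

Let mass_sub (K : finType) (c : K -> R) (k0 : K) t (A : {set K}) :
  mass (fun k => c k - (if k == k0 then t else 0)) A =
  mass c A - (if k0 \in A then t else 0).
Proof.
rewrite /mass sumrB; congr (_ - _); rewrite -big_mkcondr; case: ifPn => k0A.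
  rewrite (bigD1 k0) ?k0A ?eqxx//= big1 ?addr0// => k /andP[/andP[_ ->]//].
by rewrite big_pred0// => k; case: eqP => [->|]; rewrite ?(negbTE k0A) ?andbF.
Qed.

Let supp (K : finType) (c : K -> R) := #|[set k | c k != 0]|.

Let supp_lt (K : finType) (c c' : K -> R) k0 :
  (forall k, c k = 0 -> c' k = 0) -> c k0 != 0 -> c' k0 = 0 ->
  (supp c' < supp c)%N.
Proof.
move=> cc' ck0 c'k0; apply: proper_card; apply/properP; split.
  by apply/fintype.subsetP => k; rewrite !inE; apply: contra_neq => /cc'.
by exists k0; rewrite !inE ?ck0// c'k0 eqxx.
Qed.

Let supp_le (K : finType) (c c' : K -> R) :
  (forall k, c k = 0 -> c' k = 0) -> (supp c' <= supp c)%N.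
Proof.
move=> cc'; apply: subset_leq_card.
by apply/fintype.subsetP => k; rewrite !inE; apply: contra_neq => /cc'.
Qed.

(** Hall's condition for weights [a] on the rows and [b] on the columns. *)
Definition hall a b :=
  forall S, \sum_(i in S) a i <= \sum_(j in neighbours S) b j.

(** [w] ships the whole weight of each row along the adjacency relation without
    exceeding the weight of any column. *)
Definition transport a b (w : I -> J -> R) :=
  [/\ forall i j, 0 <= w i j, forall i j, ~~ e i j -> w i j = 0,
      forall i, \sum_j w i j = a i & forall j, \sum_i w i j <= b j].

Lemma transportD a b a' b' w w' : transport a b w -> transport a' b' w' ->
  transport (fun i => a i + a' i) (fun j => b j + b' j)
            (fun i j => w i j + w' i j).
Proof.
move=> [w0 we wa wb] [w'0 w'e w'a w'b]; split=> [i j|i j eij|i|j].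
- exact: addr_ge0.
- by rewrite we// w'e// addr0.
- by rewrite big_split/= wa w'a.
- by rewrite big_split/= lerD.
Qed.

Lemma eq_transport a b a' b' w : a =1 a' -> b =1 b' ->
  transport a b w -> transport a' b' w.
Proof. by move=> aa bb [? ? wa wb]; split => // *; rewrite -?aa -?bb. Qed.

(** Induction on the number of nonzero weights. As much mass [t] as Hall's
    condition permits is shipped along an edge [(i, j)] of positive weights.
    Either the weight of [i] or of [j] is exhausted, or some set [S] of rows
    becomes tight, with [i] outside [S] and [j] among its neighbours. In the
    latter case the problem splits into one between [S] and its neighbours,
    which has lost the row [i], and one between the complements, which has lost
    the column [j]. *)
Lemma hall_transport a b :
  (forall i, 0 <= a i) -> (forall j, 0 <= b j) -> hall a b ->
  exists w, transport a b w.
Proof.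
have [n] := ubnP (supp a + supp b); elim: n a b => // n IH a b.
rewrite ltnS => supp_n a0 b0 hab.
have [i ai|] := pickP (fun i => a i != 0); last first.
  move=> az; exists (fun _ _ => 0); split=> // [i|j]; rewrite big1//.
  by have /negbFE/eqP := az i.
have ai0 : 0 < a i by rewrite lt_def ai a0.
have [j /andP[eij bj]|] := pickP (fun j => e i j && (b j != 0)); last first.
  move=> bz; have := hab [set i]; rewrite big_set1 big1 ?leNgt ?ai0// => j.
  move=> /neighboursP[_ /finset.set1P-> eij].
  by have := bz j; rewrite eij => /negbFE/eqP.
have bj0 : 0 < b j by rewrite lt_def bj b0.
(* shipping mass along (i, j) only tightens the condition for these sets *)
pose crossing S := (i \notin S) && (j \in neighbours S).
pose slack S := mass b (neighbours S) - mass a S.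
pose a' t k := a k - (if k == i then t else 0).
pose b' t k := b k - (if k == j then t else 0).
have push t : 0 <= t -> t <= a i -> t <= b j ->
    (forall S, crossing S -> t <= slack S) ->
  [/\ forall i, 0 <= a' t i, forall j, 0 <= b' t j & hall (a' t) (b' t)].
  move=> t0 ta tb tS; split=> [k|k|S].
  - by rewrite /a' subr_ge0; case: eqP => [->|].
  - by rewrite /b' subr_ge0; case: eqP => [->|].
  have := hab S; rewrite -/(mass _ _) -/(mass b _) => habS.
  rewrite -/(mass _ _) -/(mass (b' t) _) !mass_sub.
  have [iS|iS] := boolP (i \in S).
    suff -> : j \in neighbours S by rewrite lerD2r.
    by apply/neighboursP; exists i.
  rewrite subr0; case: ifPn => [jS|_]; last by rewrite subr0.
  by have := tS S; rewrite /crossing iS jS => /(_ isT); rewrite /slack; lra.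
have unpush t w : 0 <= t -> transport (a' t) (b' t) w ->
    exists w, transport a b w.
  move=> t0 tw; pose d k l : R := if (k == i) && (l == j) then t else 0.
  exists (fun k l => w k l + d k l).
  apply: (@eq_transport (fun k => a' t k + (if k == i then t else 0))
     (fun k => b' t k + (if k == j then t else 0))).
  - by move=> k; rewrite subrK.
  - by move=> k; rewrite subrK.
  apply: transportD => //; split=> [k l|k l|k|l]; rewrite /d.
  - by case: ifP.
  - by case: andP => // -[/eqP-> /eqP->]; rewrite eij.
  - rewrite -big_mkcond; case: eqP => _ /=; last by rewrite big_pred0_eq.
    by rewrite big_pred1_eq.
  - rewrite -big_mkcond; case: eqP => _ /=.
    + by rewrite (big_pred1 i)// => k; rewrite andbT.
    + by rewrite big_pred0// => k; rewrite andbF.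
have suppa t : (supp (a' t) <= supp a)%N.
  apply: supp_le => k ak; rewrite /a' ak.
  case: eqP => [ki|]; last by rewrite subr0.
  by move: ai0; rewrite -ki ak ltxx.
have suppb t : (supp (b' t) <= supp b)%N.
  apply: supp_le => k ak; rewrite /b' ak.
  case: eqP => [ki|]; last by rewrite subr0.
  by move: bj0; rewrite -ki ak ltxx.
have exhaust t : 0 <= t -> t <= a i -> t <= b j -> (t = a i) \/ (t = b j) ->
    (forall S, crossing S -> t <= slack S) -> exists w, transport a b w.
  move=> t0 ta tb tab tS; have [? ? ?] := push _ t0 ta tb tS.
  suff [w tw] : exists w, transport (a' t) (b' t) w by exact: unpush tw.
  apply: IH => //; apply: (leq_trans _ supp_n); case: tab => tE.
  - rewrite -addSn leq_add//; apply: (@supp_lt _ _ _ i) => //.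
    + move=> k ak; rewrite /a' ak; case: eqP => [ki|]; last by rewrite subr0.
      by move: ai0; rewrite -ki ak ltxx.
    + by rewrite /a' eqxx tE subrr.
  - rewrite -addnS leq_add//; apply: (@supp_lt _ _ _ j) => //.
    + move=> k ak; rewrite /b' ak; case: eqP => [ki|]; last by rewrite subr0.
      by move: bj0; rewrite -ki ak ltxx.
    + by rewrite /b' eqxx tE subrr.
pose t0 := Num.min (a i) (b j).
have t0_ge0 : 0 <= t0 by rewrite le_min !ltW.
have [t0a t0b] : t0 <= a i /\ t0 <= b j by rewrite /t0 !ge_min !lexx orbT.
have [/forallP t0S|/forallPn[S1]] :=
    boolP [forall S, crossing S ==> (t0 <= slack S)].
  apply: (exhaust t0) => // [|S cS].
    by rewrite /t0 minEle; case: ifP; [left|right].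
  by have /implyP/(_ cS) := t0S S.
rewrite negb_imply -ltNge => /andP[cS1 S1t].
have [S cS minS] := Order.TotalTheory.arg_minP slack cS1.
(* the slack of [S] is minimal, so shipping it makes [S] tight *)
set t := slack S.
have t_ge0 : 0 <= t by rewrite subr_ge0; exact: hab.
have tt0 : t < t0 by apply: le_lt_trans S1t; exact: minS.
have [] := push t t_ge0 _ _ minS; [lra|lra|].
set al := a' t; set be := b' t => al0 be0 hall'.
have tight : mass al S = mass be (neighbours S).
  case/andP: cS => iS jS; rewrite !mass_sub jS (negbTE iS) /t /slack; lra.
suff [w tw] : exists w, transport al be w by exact: unpush tw.
pose NS := neighbours S.
have [w1 tw1] : exists w, transport (fun k => if k \in S then al k else 0)
    (fun l => if l \in NS then be l else 0) w.
  apply: IH.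
  - apply: (leq_trans _ supp_n); rewrite -addSn leq_add//; last first.
      apply: (leq_trans _ (suppb t)); apply: supp_le => k.
      by rewrite -/be => ->; rewrite if_same.
    apply: (leq_trans _ (suppa t)); apply: (@supp_lt _ _ _ i).
    + by move=> k; rewrite -/al => ->; rewrite if_same.
    + by rewrite /a' eqxx subr_eq0 eq_sym; lra.
    + by case/andP: cS => /negbTE->.
  - by move=> k; case: ifP.
  - by move=> k; case: ifP.
  - move=> T; rewrite -/(mass _ _) mass_restr.
    rewrite -/(mass (fun _ => if _ then _ else _) _) mass_restr.
    apply: (le_trans (hall' (T :&: S))); apply: massS => //.
    by rewrite finset.subsetI !neighboursS// ?finset.subsetIl ?finset.subsetIr.
have [w2 tw2] : exists w, transport (fun k => if k \in ~: S then al k else 0)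
    (fun l => if l \in ~: NS then be l else 0) w.
  apply: IH.
  - apply: (leq_trans _ supp_n); rewrite -addnS leq_add//.
      apply: (leq_trans _ (suppa t)); apply: supp_le => k.
      by rewrite -/al => ->; rewrite if_same.
    apply: (leq_trans _ (suppb t)); apply: (@supp_lt _ _ _ j).
    + by move=> k; rewrite -/be => ->; rewrite if_same.
    + by rewrite /b' eqxx subr_eq0 eq_sym; lra.
    + by case/andP: cS => _; rewrite finset.in_setC => ->.
  - by move=> k; case: ifP.
  - by move=> k; case: ifP.
  - move=> T; rewrite -/(mass _ _) mass_restr.
    rewrite -/(mass (fun _ => if _ then _ else _) _) mass_restr.
    rewrite -!finset.setDE.
    have := hall' (S :|: T); rewrite -/(mass _ _) -/(mass be _).
    by rewrite neighboursU !massU tight lerD2l.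
exists (fun i j => w1 i j + w2 i j).
apply: eq_transport (transportD tw1 tw2) => k; rewrite finset.in_setC.
  by case: ifP => _ /=; rewrite ?addr0 ?add0r.
by case: ifP => _ /=; rewrite ?addr0 ?add0r.
Qed.

End RealWeights.
End Hall.

Lemma sum_option (V : nmodType) (J : finType) (F : option J -> V) :
  \sum_o F o = F None + \sum_j F (Some j).
Proof.
rewrite (bigD1 None)//=; congr (_ + _).
rewrite (reindex_omap Some id); last by case.
by apply: eq_bigl => j; rewrite eqxx.
Qed.

(** Finite form of Strassen's theorem: if Hall's condition holds up to a
    deficiency [eta], then there is a transport plan with marginals [a] and [b]
    that moves mass at most [eta] between nonadjacent indices. *)
Lemma finite_strassen (R : realFieldType) (I J : finType) (e : I -> J -> bool)
    (a : I -> R) (b : J -> R) (eta : R) :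
  (forall i, 0 <= a i) -> (forall j, 0 <= b j) -> \sum_i a i = \sum_j b j ->
  (forall S : {set I},
     \sum_(i in S) a i <= \sum_(j in neighbours e S) b j + eta) ->
  exists w : I -> J -> R,
    [/\ forall i j, 0 <= w i j, forall i, \sum_j w i j = a i,
        forall j, \sum_i w i j = b j
      & \sum_i \sum_(j | ~~ e i j) w i j <= eta].
Proof.
move=> a0 b0 ab hab.
have eta0 : 0 <= eta.
  have := hab finset.set0; rewrite big_set0 big1 ?add0r// => j /neighboursP[i].
  by rewrite inE.
(* an extra column of weight eta, adjacent to every row, absorbs the deficit *)
pose e' i (o : option J) := if o is Some j then e i j else true.
pose b' (o : option J) := if o is Some j then b j else eta.
have [w] : exists w, transport e' a b' w.
  apply: hall_transport => [|[j|]|S]; [exact: a0|exact: b0|exact: eta0|].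
  have [->|[i iS]] := finset.set_0Vmem S.
    by rewrite big_set0 sumr_ge0// => -[j|] _; [exact: b0|exact: eta0].
  apply: (le_trans (hab S)); rewrite [leRHS](bigD1 None)/=; last first.
    by apply/neighboursP; exists i.
  rewrite [leRHS]addrC lerD2r.
  rewrite [leRHS]big_mkcond sum_option/= andbF/= add0r -big_mkcond /=.
  rewrite le_eqVlt; apply/orP; left; apply/eqP; apply: eq_bigl => j.
  by rewrite andbT; apply/neighboursP/neighboursP => -[k kS ekj]; exists k.
move=> [w0 we wa wb].
(* the shipped masses [r] and [c] leave residues [p] and [q] of equal total
   mass [t], which are coupled independently of each other *)
pose r i := \sum_j w i (Some j).
pose c j := \sum_i w i (Some j).
pose p i := a i - r i; pose q j := b j - c j.
have rE i : p i = w i None by rewrite /p -wa sum_option/= addrK.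
have p0 i : 0 <= p i by rewrite rE.
have q0 j : 0 <= q j by rewrite subr_ge0; exact: (wb (Some j)).
pose t := \sum_i p i.
have t0 : 0 <= t by apply: sumr_ge0.
have tq : \sum_j q j = t.
  by rewrite /t /p /q !sumrB -ab /r /c exchange_big.
have teta : t <= eta.
  by rewrite /t (eq_bigr _ (fun i _ => rE i)); exact: (wb None).
have pt i : p i * t / t = p i.
  have [tz|tz] := eqVneq t 0; last by rewrite mulfK.
  have : p i = 0 by exact: (psumr_eq0P (fun i _ => p0 i) tz).
  by move=> ->; rewrite !mul0r.
have qt j : t * q j / t = q j.
  have [tz|tz] := eqVneq t 0; last by rewrite mulrAC divff// mul1r.
  have : q j = 0 by rewrite -tq in tz; exact: (psumr_eq0P (fun j _ => q0 j) tz).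
  by move=> ->; rewrite mulr0 mul0r.
exists (fun i j => w i (Some j) + p i * q j / t); split=> [i j|i|j|].
- by rewrite addr_ge0// divr_ge0// mulr_ge0.
- by rewrite big_split/= -mulr_suml -mulr_sumr tq pt addrC subrK.
- by rewrite big_split/= -mulr_suml -mulr_suml qt addrC subrK.
apply: le_trans teta; rewrite /t; apply: ler_sum => i _.
rewrite (eq_bigr (fun j => p i * q j / t)); last first.
  by move=> j eij; rewrite we// add0r.
rewrite -[leRHS]pt -tq mulr_sumr mulr_suml [leRHS](bigID (fun j => ~~ e i j))/=.
rewrite lerDl; apply: sumr_ge0 => j _; rewrite divr_ge0// ?mulr_ge0//.
by rewrite tq.
Qed.

(** * Borel sets of a separable metric space *)

Local Open Scope classical_set_scope.
Local Open Scope ereal_scope.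

Section metric.
Context {R : realType} {Omega : pointedMetricType R}.
Implicit Types (x y : Omega) (B : set Omega).

Lemma open_measurable_borel B : open B -> measurable (B : set (borel Omega)).
Proof. by move=> oB; exact: sub_sigma_algebra. Qed.

Lemma mball_open x (r : R) : open [set y | (mdist x y < r)%R].
Proof.
have [r0|r0] := ltP 0%R r; last first.
  rewrite (_ : mkset _ = set0); first exact: open0.
  by rewrite -subset0 => y /=; rewrite ltNge (le_trans r0)// mdist_ge0.
rewrite openE => y /= xyr; apply/nbhs_ballP; exists (r - mdist x y)%R => /=.
  by rewrite subr_gt0.
move=> z; rewrite ballEmdist/= ltrBrDl; apply: le_lt_trans.
exact: metric_triangle.
Qed.

Lemma thickeningP (eps : R) B x :
  thickening eps B x <->
  forall r, (0 < r)%R -> exists2 y, B y & (mdist x y < eps + r)%R.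
Proof.
rewrite /thickening/=; split=> [h r r0|h].
  have : ereal_inf [set (mdist x y)%:E | y in B] < (eps + r)%:E.
    by apply: (le_lt_trans h); rewrite lte_fin ltrDl.
  by move=> /ereal_inf_lt[_ [y By <-]]; rewrite lte_fin => ?; exists y.
apply/lee_addgt0Pr => r r0; have [y By xy] := h r r0.
apply: (@le_trans _ _ (mdist x y)%:E); last by rewrite -EFinD lee_fin ltW.
by apply: ereal_inf_lbound; exists y.
Qed.

Lemma measurable_thickening (eps : R) B :
  measurable (thickening eps B : set (borel Omega)).
Proof.
rewrite (_ : thickening eps B = \bigcap_n \bigcup_(y in B)
    [set x | (mdist y x < eps + n.+1%:R^-1)%R]); last first.
  apply/seteqP; split => x.
    move=> /thickeningP h n _; have [|y By xy] := h n.+1%:R^-1%R.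
      by rewrite invr_gt0.
    by exists y => //=; rewrite metric_sym.
  move=> h; apply/thickeningP => r r0.
  have [n /ltW nr] : exists n, (n.+1%:R^-1 < r)%R.
    by have [n] := ltr_add_invr r0; rewrite add0r; exists n.
  have [y By/=] := h n I; rewrite metric_sym => xy; exists y => //.
  by apply: (lt_le_trans xy); rewrite lerD2l.
apply: bigcap_measurable => // n _; apply: open_measurable_borel.
by apply: bigcup_open => y _; exact: mball_open.
Qed.

(** A separable space has a dense sequence, here in metric form; the space is
    pointed, so the countable dense set is not empty. *)
Lemma separable_seq : separable Omega ->
  exists s : nat -> Omega, forall x (r : R), (0 < r)%R ->
    exists n, (mdist (s n) x < r)%R.
Proof.
move=> [S cS dS].
have S0 : S !=set0.
  have [|x [_ Sx]] := dS setT _ openT; first by exists point.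
  by exists x.
have /pfcard_geP[S_eq0|[f]] := cS; first by case: S0 => x; rewrite S_eq0.
exists f => x r r0.
have [|y [/=xy Sy]] := dS [set y | (mdist x y < r)%R] _ (mball_open x r).
  by exists x; rewrite /= mdistxx.
have [n _ fn] := @surj _ _ _ _ f y Sy.
by exists n; rewrite fn metric_sym.
Qed.

Lemma measurable_mdist1 x :
  measurable_fun setT (mdist x : borel Omega -> R).
Proof.
apply: (measurability _ (RGenInftyO.measurableE R)) => //.
move=> _ [_ [r ->] <-]; rewrite setTI; apply: open_measurable_borel.
rewrite (_ : _ @^-1` _ = [set y | (mdist x y < r)%R]); first exact: mball_open.
by apply/seteqP; split => y/=; rewrite in_itv.
Qed.

(** With [s] dense, [mdist x y < r] if and only if
    [mdist (s n) x + mdist (s n) y < r] for some [n]. *)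
Lemma measurable_mdist : separable Omega ->
  measurable_fun setT (fun w : borel Omega * borel Omega =>
    mdist (w.1 : Omega) (w.2 : Omega)).
Proof.
move=> /separable_seq[s sP].
apply: (measurability _ (RGenInftyO.measurableE R)) => //.
move=> _ [_ [r ->] <-]; rewrite setTI.
pose F n (w : borel Omega * borel Omega) :=
  (mdist (s n) w.1 + mdist (s n) w.2)%R.
have mF n : measurable_fun setT (F n).
  apply: measurable_funD.
    exact: (measurableT_comp (measurable_mdist1 (s n)) measurable_fst).
  exact: (measurableT_comp (measurable_mdist1 (s n)) measurable_snd).
rewrite (_ : _ @^-1` _ = \bigcup_n (F n @^-1` `]-oo, r[)).
  apply: bigcup_measurable => n _.
  by rewrite -[X in measurable X]setTI; exact: mF.
apply/seteqP; split => -[x y]/=; rewrite ?in_itv/=.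
- move=> xyr; have [|n nx] := sP x ((r - mdist x y) / 2)%R.
    by rewrite divr_gt0// subr_gt0.
  exists n => //=; rewrite in_itv/= /F/=.
  have := metric_triangle (s n) x y; lra.
- move=> [n _]/=; rewrite in_itv/= /F/=; apply: le_lt_trans.
  by rewrite (metric_sym (s n) x); exact: metric_triangle.
Qed.

End metric.

(** * Markov's inequality and the lower bound *)

Section prokhorov.
Context {R : realType} {Omega : pointedMetricType R}.
Context (mu nu : probability (borel Omega) R).

(** The values [eps] over which the Prokhorov metric is the infimum. *)
Definition prokhorov_radius (eps : R) := (0 < eps)%R /\
  forall B : set (borel Omega), measurable B ->
    mu B <= nu (thickening eps B) + eps%:E.

Lemma prokhorov_radius1 : prokhorov_radius 1.
Proof.
split=> // B mB; apply: (le_trans (probability_le1 mu mB)).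
by rewrite leeDr.
Qed.

Lemma prokhorov_le eps : prokhorov_radius eps -> prokhorov mu nu <= eps%:E.
Proof. by move=> heps; apply: ereal_inf_lbound; exists eps. Qed.

Lemma prokhorov_ge0 : 0 <= prokhorov mu nu.
Proof.
by apply: le_ereal_inf_tmp => _ [eps [/ltW eps0 _] <-]; rewrite lee_fin.
Qed.

Lemma prokhorov_fin_num : prokhorov mu nu \is a fin_num.
Proof.
rewrite ge0_fin_numE ?prokhorov_ge0//.
exact: le_lt_trans (prokhorov_le prokhorov_radius1) (ltry _).
Qed.

(** Markov's inequality: [J] gives mass at most [eps] to the pairs at distance
    at least [eps]; off these pairs, [B] is mapped into its thickening. *)
Lemma coupling_prokhorov_radius
    (J : probability (borel Omega * borel Omega)%type R) (eps : R) :
  separable Omega -> coupling mu nu J -> (0 < eps)%R ->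
  'E_J[(fun w : borel Omega * borel Omega =>
          mdist (w.1 : Omega) (w.2 : Omega))] <= (eps ^+ 2)%:E ->
  prokhorov_radius eps.
Proof.
move=> sO cJ eps0 EJ; split=> // B mB.
set d := fun w : borel Omega * borel Omega =>
  mdist (w.1 : Omega) (w.2 : Omega).
have md : measurable_fun setT d := measurable_mdist sO.
pose far : set (borel Omega * borel Omega) := [set w | eps%:E <= `|(d w)%:E|].
have mfar : measurable far.
  rewrite -[X in measurable X]setTI; apply: emeasurable_fun_c_infty => //.
  by apply: measurableT_comp => //; exact/measurable_EFinP.
have Jfar : J far <= eps%:E.
  have : eps%:E * J far <= (eps ^+ 2)%:E.
    apply: le_trans EJ; rewrite unlock.
    have := @le_integral_comp_abse _ _ _ J setT measurableT (EFin \o d) eps id.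
    rewrite setTI => /(_ (@measurable_id _ _ _) (fun _ h => h)) /=.
    move=> /(_ (fun _ _ _ _ h => h))/= => h.
    apply: (le_trans (h _ eps0)); first exact/measurable_EFinP.
    rewrite le_eqVlt; apply/orP; left; apply/eqP; apply: eq_integral => w _.
    by rewrite ger0_norm// mdist_ge0.
  by rewrite expr2 EFinM lee_pmul2l// lte_fin.
have mT := measurable_thickening eps B.
have [<- _] := cJ B mB; have [_ <-] := cJ _ mT; rewrite /pushforward.
have mB1 : measurable (fst @^-1` B : set (borel Omega * borel Omega)).
  by rewrite -[X in measurable X]setTI; exact: measurable_fst.
have mT2 : measurable (snd @^-1` (thickening eps B : set (borel Omega))
    : set (borel Omega * borel Omega)).
  by rewrite -[X in measurable X]setTI; exact: measurable_snd.
apply: (@le_trans _ _ (J (snd @^-1` (thickening eps B) `|` far))).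
  apply: le_measure; rewrite ?inE//; first exact: measurableU.
  move=> [x y]/= Bx; have [xy|xy] := leP eps (mdist x y).
    by right; rewrite /far/= lee_fin ger0_norm ?mdist_ge0.
  left => /=; apply/thickeningP => r r0; exists x => //.
  by rewrite metric_sym (lt_trans xy)// ltrDl.
apply: (le_trans (measureU2 _ _ _)) => //; exact: leeD2l.
Qed.

Lemma sqr_prokhorov_le : separable Omega ->
  prokhorov mu nu ^+ 2 <= wasserstein mu nu.
Proof.
move=> sO; apply: le_ereal_inf_tmp => _ [J cJ <-].
set E := 'E_J[_].
have E0 : 0 <= E.
  by rewrite /E unlock; apply: integral_ge0 => w _; rewrite lee_fin mdist_ge0.
have [Efin|] := boolP (E \is a fin_num); last first.
  by rewrite ge0_fin_numE// -leNgt leye_eq => /eqP ->; rewrite leey.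
rewrite -(fineK prokhorov_fin_num) -EFin_expe -[leRHS]fineK// lee_fin.
set p := fine _; set e := fine E.
have p0 : (0 <= p)%R by exact: fine_ge0 prokhorov_ge0.
have e0 : (0 <= e)%R by exact: fine_ge0.
(* every number greater than the square root of [e] is admissible *)
rewrite -[leRHS]sqr_sqrtr// ler_pXn2r ?nnegrE ?sqrtr_ge0//.
apply/ler_addgt0Pr => r r0.
rewrite -lee_fin fineK ?prokhorov_fin_num//; apply: prokhorov_le.
apply: (coupling_prokhorov_radius sO cJ); first by rewrite ltr_wpDl// sqrtr_ge0.
rewrite -/E -(fineK Efin) lee_fin -/e -[leLHS]sqr_sqrtr// ler_pXn2r//.
- by rewrite lerDl ltW.
- by rewrite nnegrE sqrtr_ge0.
- by rewrite nnegrE addr_ge0 ?sqrtr_ge0// ltW.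
Qed.

End prokhorov.

(** * Lifting a coupling of cells *)

Section sum_measure.
Context d (T : measurableType d) (R : realType) (I : finType).
Context (m : I -> {measure set T -> \bar R}).

(** The sum of a family of measures indexed by a finite type. *)
Definition sum_measure (A : set T) : \bar R := \sum_i m i A.

Let sum_measure0 : sum_measure set0 = 0.
Proof. by rewrite /sum_measure big1. Qed.

Let sum_measure_ge0 B : 0 <= sum_measure B.
Proof. by rewrite /sum_measure; apply: sume_ge0. Qed.

Let sum_measure_sigma_additive : semi_sigma_additive sum_measure.
Proof.
move=> F mF tF mUF; rewrite [X in _ --> X](_ : _ =
    lim ((fun n => \sum_(0 <= i < n) sum_measure (F i)) @ \oo)).
  by apply: is_cvg_ereal_nneg_natsum => k _; exact: sume_ge0.
rewrite nneseries_sum//; apply: eq_bigr => /= i _.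
exact: measure_semi_bigcup.
Qed.

HB.instance Definition _ := isMeasure.Build _ _ _ sum_measure
  sum_measure0 sum_measure_ge0 sum_measure_sigma_additive.

End sum_measure.

Lemma sum_fsbig (V : nmodType) (I : finType) (P : pred I) (F : I -> V) :
  (\sum_(i | P i) F i)%R = (\sum_(i \in [set` P]) F i)%R.
Proof.
by apply: bigfs; [exact: index_enum_uniq|move=> i _; rewrite mem_index_enum].
Qed.

Lemma measure_fin_cells d (T : measurableType d) (R : realType)
    (mu : {measure set T -> \bar R}) (I : finType) (P : pred I)
    (A : I -> set T) :
  (forall i, measurable (A i)) -> trivIset setT A ->
  mu (\bigcup_(i in [set` P]) A i) = \sum_(i | P i) mu (A i).
Proof.
move=> mA tA; rewrite sum_fsbig measure_fin_bigcup//.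
exact: sub_trivIset tA.
Qed.

Lemma probability_fin d (T : measurableType d) (R : realType)
    (P : probability T R) (A : set T) : measurable A -> P A = (fine (P A))%:E.
Proof. by move=> mA; rewrite fineK// fin_num_measure. Qed.

Lemma probability_fin_cells d (T : measurableType d) (R : realType)
    (P : probability T R) (I : finType) (A : I -> set T) (C : set T) :
  (forall i, measurable (A i)) -> trivIset setT A -> \bigcup_i A i = setT ->
  measurable C -> P C = (\sum_i fine (P (C `&` A i)))%:E.
Proof.
move=> mA tA cA mC; rewrite -[in LHS](setIT C) -cA setI_bigcupr.
have mCA i : measurable (C `&` A i) by exact: measurableI.
rewrite (_ : \bigcup_(i in _) _ = \bigcup_(i in [set` predT]) (C `&` A i)).
  rewrite measure_fin_cells//; last exact: trivIset_setIl.
  by rewrite -sumEFin; apply: eq_bigr => i _; rewrite -probability_fin.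
by apply: eq_bigcupl; split.
Qed.

Lemma fine_probability_null d (T : measurableType d) (R : realType)
    (P : probability T R) (A C : set T) :
  measurable A -> measurable C -> P A = 0 -> fine (P (C `&` A)) = 0%R.
Proof.
move=> mA mC PA; suff -> : P (C `&` A) = 0 by [].
apply/eqP; rewrite -measure_le0 -PA; apply: le_measure; rewrite ?inE//.
exact: measurableI.
Qed.

(** Two probability spaces with finite measurable partitions [A] and [B], and a
    matrix [w] whose rows and columns sum to the weights of the cells. *)
Section glue.
Context d1 d2 (T1 : measurableType d1) (T2 : measurableType d2) (R : realType).
Context (mu : probability T1 R) (nu : probability T2 R).
Context (I J : finType) (A : I -> set T1) (B : J -> set T2).
Context (mA : forall i, measurable (A i)) (mB : forall j, measurable (B j)).
Context (tA : trivIset setT A) (tB : trivIset setT B).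
Context (cA : \bigcup_i A i = setT) (cB : \bigcup_j B j = setT).
Context (w : I -> J -> R) (w0 : forall i j, (0 <= w i j)%R).
Context (wA : forall i, (\sum_j w i j)%:E = mu (A i)).
Context (wB : forall j, (\sum_i w i j)%:E = nu (B j)).

Let a i : R := (\sum_j w i j)%R.
Let b j : R := (\sum_i w i j)%R.

Let a_ge0 i : (0 <= a i)%R. Proof. exact: sumr_ge0. Qed.
Let b_ge0 i : (0 <= b i)%R. Proof. exact: sumr_ge0. Qed.

Let c (p : I * J) : {nonneg R} :=
  NngNum (divr_ge0 (w0 p.1 p.2) (mulr_ge0 (a_ge0 p.1) (b_ge0 p.2))).

Let mAB (p : I * J) : measurable (A p.1 `*` B p.2).
Proof. exact: measurableX. Qed.

(* The measure with density w i j / (a i * b j) on A i `*` B j; the division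
   by zero is harmless as w i j vanishes with a i or b j. *)
Local Notation glue := (sum_measure (fun p : I * J =>
  mscale (c p) (mrestr (mu \x nu) (mAB p)))).

Let glueX C D : measurable C -> measurable D ->
  glue (C `*` D) = (\sum_i \sum_j w i j / (a i * b j) *
     (fine (mu (C `&` A i)) * fine (nu (D `&` B j))))%:E.
Proof.
move=> mC mD; rewrite pair_bigA/= /sum_measure -sumEFin.
apply: eq_bigr => -[i j] _.
rewrite [RHS]EFinM; congr (_ * _).
change ((mu \x nu) (C `*` D `&` A i `*` B j) =
  (fine (mu (C `&` A i)) * fine (nu (D `&` B j)))%:E).
rewrite -setXI.
rewrite [LHS]product_measure1E ?EFinM -?probability_fin//; exact: measurableI.
Qed.

Let w_a0 i j : a i = 0%R -> w i j = 0%R.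
Proof. by move=> ai; exact: (psumr_eq0P (fun j _ => w0 i j) ai). Qed.

Let w_b0 i j : b j = 0%R -> w i j = 0%R.
Proof. by move=> bj; exact: (psumr_eq0P (fun i _ => w0 i j) bj). Qed.

Let glue1 C : measurable C -> glue (C `*` setT) = mu C.
Proof.
move=> mC; rewrite glueX//.
rewrite (probability_fin_cells mu mA tA cA mC).
congr EFin; apply: eq_bigr => i _.
have [ai0|ai0] := eqVneq (a i) 0%R.
  rewrite big1; last by move=> j _; rewrite w_a0// !mul0r.
  by rewrite fine_probability_null// -wA -/(a i) ai0.
transitivity (\sum_j w i j / a i * fine (mu (C `&` A i)))%R; last first.
  by rewrite -!mulr_suml -/(a i) divff// mul1r.
apply: eq_bigr => j _; rewrite setTI -wB/= -/(b j).
have [bj0|bj0] := eqVneq (b j) 0%R; first by rewrite w_b0// !mul0r.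
by rewrite invfM !mulrA mulrAC mulfVK// mulrAC.
Qed.

Let glue2 D : measurable D -> glue (setT `*` D) = nu D.
Proof.
move=> mD; rewrite glueX//.
rewrite (probability_fin_cells nu mB tB cB mD).
rewrite exchange_big/=; congr EFin; apply: eq_bigr => j _.
have [bj0|bj0] := eqVneq (b j) 0%R.
  rewrite big1; last by move=> i _; rewrite w_b0// !mul0r.
  by rewrite fine_probability_null// -wB -/(b j) bj0.
transitivity (\sum_i w i j / b j * fine (nu (D `&` B j)))%R; last first.
  by rewrite -!mulr_suml -/(b j) divff// mul1r.
apply: eq_bigr => i _; rewrite setTI -wA/= -/(a i).
have [ai0|ai0] := eqVneq (a i) 0%R; first by rewrite w_a0// !mul0r.
by rewrite mulrA [(a i * b j)%R]mulrC invfM [(w i j * (_ * _))%R]mulrA mulfVK.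
Qed.

Let glueAB i j : glue (A i `*` B j) = (w i j)%:E.
Proof.
rewrite glueX//; congr EFin; rewrite (bigD1 i)//= (bigD1 j)//= !setIid.
rewrite [X in (_ + X + _)%R]big1 ?addr0; last first.
  move=> j' j'j; rewrite (_ : B j `&` B j' = set0) ?measure0 ?mulr0//.
  by move/trivIsetP : tB; apply=> //; rewrite eq_sym.
rewrite [X in (_ + X)%R]big1 ?addr0; last first.
  move=> i' i'i; rewrite big1// => j' _; rewrite (_ : A i `&` A i' = set0).
    by rewrite measure0 mul0r mulr0.
  by move/trivIsetP : tA; apply=> //; rewrite eq_sym.
rewrite -wA -wB/= -/(a i) -/(b j).
have [ai0|ai0] := eqVneq (a i) 0%R; first by rewrite w_a0// !mul0r.
have [bj0|bj0] := eqVneq (b j) 0%R; first by rewrite w_b0// !mul0r.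
by rewrite mulfVK// mulf_neq0.
Qed.

(** A coupling of the weights of the cells lifts to a coupling of the laws. *)
Lemma coupling_of_cells : exists P : probability (T1 * T2)%type R,
  [/\ forall C, measurable C -> pushforward P fst C = mu C,
      forall D, measurable D -> pushforward P snd D = nu D &
      forall i j, P (A i `*` B j) = (w i j)%:E].
Proof.
have glueT : glue setT = 1 by rewrite -setXTT glue1// probability_setT.
pose M := Measure_isProbability.Build _ _ _ glue glueT.
pose P : probability (T1 * T2)%type R := HB.pack glue M.
exists P; split => [C mC|D mD|//].
- by rewrite -glue1// /pushforward -setXT.
- by rewrite -glue2// /pushforward -setTX.
Qed.

End glue.

(** * Strassen's theorem and the upper bound *)

(** A countable cover is, up to arbitrarily small mass, a finite one. *)
Lemma probability_exhaust d (T : measurableType d) (R : realType)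
    (P : probability T R) (F : (set T)^nat) (r : R) :
  (forall n, measurable (F n)) -> \bigcup_n F n = setT -> (0 < r)%R ->
  \forall n \near \oo, P (~` \big[setU/set0]_(k < n) F k) <= r%:E.
Proof.
move=> mF FT r0; pose G n := \big[setU/set0]_(k < n) F k.
have mG n : measurable (G n) by exact: bigsetU_measurable.
have GT : \bigcup_n G n = setT.
  rewrite -subTset -FT => x [n _ Fx]; exists n.+1 => //.
  by rewrite /G -bigcup_mkord; exists n => /=.
have PG : P (G n) @[n --> \oo] --> 1.
  rewrite -(probability_setT P) -GT; apply: nondecreasing_cvg_mu => //.
  - by rewrite GT.
  - by move=> m n mn; rewrite subsetEset; exact: subset_bigsetU.
have : nbhs (1 : \bar R) [set y | (1 - r)%:E < y].
  apply: open_nbhs_nbhs; split; first exact: open_ereal_gt_ereal.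
  by rewrite /= lte_fin ltrBlDr ltrDl.
move=> /PG[M _ MP]; exists M => // n /= /MP /= Gn; rewrite -/(G n).
rewrite probability_setC// (probability_fin _ (mG n)) -EFinB lee_fin.
by move: Gn; rewrite (probability_fin _ (mG n)) lte_fin; lra.
Qed.

Section strassen.
Context {R : realType} {Omega : pointedMetricType R}.
Context (mu nu : probability (borel Omega) R).

Let dist (w : borel Omega * borel Omega) : R :=
  mdist (w.1 : Omega) (w.2 : Omega).

Lemma measurable_far (K : R) :
  separable Omega -> measurable [set w | (K < dist w)%R].
Proof.
move=> sO; rewrite (_ : mkset _ = dist @^-1` `]K, +oo[); last first.
  by apply/seteqP; split => w /=; rewrite in_itv/= andbT.
by rewrite -[X in measurable X]setTI; exact: (measurable_mdist sO).
Qed.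

(** Approximate Strassen theorem. The slack [5 * r] in the distance is made of
    [r] from the adjacency of the cells and of twice the bound [2 * r] on their
    diameter; the slack [2 * r] in the mass comes from the remainder cell, once
    for each law. *)
Lemma strassen (eps r : R) : separable Omega -> prokhorov_radius mu nu eps ->
  (0 < r)%R ->
  exists2 P, coupling mu nu P &
    P [set w | (eps + 5 * r < dist w)%R] <= (eps + 2 * r)%:E.
Proof.
move=> sO [eps0 epsP] r0; have [s sP] := separable_seq sO.
pose F n : set (borel Omega) := [set y | (mdist (s n) y < r)%R].
have mF n : measurable (F n) by apply: open_measurable_borel; exact: mball_open.
have FT : \bigcup_n F n = setT.
  by rewrite -subTset => x _; have [n nx] := sP x r r0; exists n.
pose G n := \big[setU/set0]_(k < n) F k.
have mG n : measurable (G n) by exact: bigsetU_measurable.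
have [N [muN nuN]] : exists N, mu (~` G N) <= r%:E /\ nu (~` G N) <= r%:E.
  have [N _ NP] := filterI (probability_exhaust mu mF FT r0)
    (probability_exhaust nu mF FT r0).
  by exists N; exact: NP (leqnn N).
(* the last cell is the remainder, the other ones are the disjoint pieces of
   the balls of radius [r] *)
pose cell (i : 'I_N.+1) : set (borel Omega) :=
  if (i < N)%N then seqDU F i else ~` G N.
have mcell i : measurable (cell i).
  rewrite /cell; case: ifP => _; last exact: measurableC.
  by apply: measurableD => //; exact: bigsetU_measurable.
have cellG i x : cell i x -> G N x -> (i < N)%N by rewrite /cell; case: ifP.
have cellF (i : 'I_N.+1) x : (i < N)%N -> cell i x -> F i x.
  by move=> iN; rewrite /cell iN; exact: subset_seqDU.
have FG (i : nat) x : (i < N)%N -> F i x -> G N x.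
  by move=> iN Fx; rewrite /G -bigcup_mkord; exists i.
have tcell : trivIset setT cell.
  move=> i j _ _ [x [ix jx]].
  have [Gx|nGx] := pselect (G N x).
    have iN := cellG _ _ ix Gx; have jN := cellG _ _ jx Gx.
    move: ix jx; rewrite /cell iN jN => ix jx.
    by apply/val_inj; apply: (trivIset_seqDU F) => //; exists x.
  have last_cell k : cell k x -> k = ord_max.
    move=> kx; apply/val_inj => /=; apply/eqP.
    rewrite eqn_leq -ltnS ltn_ord leqNgt.
    by apply/negP => kN; apply: nGx; exact: (FG k) (cellF _ _ kN kx).
  by rewrite (last_cell i)// (last_cell j).
have ccell : \bigcup_i cell i = setT.
  rewrite -subTset => x _; have [|nGx] := pselect (G N x).
    rewrite /G bigsetU_seqDU -bigcup_mkord => -[k /= kN kx].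
    by exists (Ordinal (ltnW kN : (k < N.+1)%N)) => //; rewrite /cell/= kN.
  by exists ord_max => //; rewrite /cell/= ltnn.
(* adjacency; the remainder is adjacent to no cell *)
pose e (i j : 'I_N.+1) := [&& i < N, j < N &
  `[< exists x y, [/\ cell i x, cell j y & (mdist x y < eps + r)%R] >]]%N.
pose a i := fine (mu (cell i)); pose b j := fine (nu (cell j)).
pose U (S : {set 'I_N.+1}) := \bigcup_(i in [set` S]) cell i.
have mU S : measurable (U S).
  by apply: fin_bigcup_measurable => //; exact: finite_finpred.
have aS (S : {set 'I_N.+1}) : (\sum_(i in S) a i)%:E = mu (U S).
  rewrite measure_fin_cells// -sumEFin; apply: eq_bigr => i _.
  by rewrite -probability_fin.
have bS (S : {set 'I_N.+1}) : (\sum_(i in S) b i)%:E = nu (U S).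
  rewrite measure_fin_cells// -sumEFin; apply: eq_bigr => i _.
  by rewrite -probability_fin.
have [||||w [w0 wa wb wbad]] := @finite_strassen R _ _ e a b (eps + 2 * r).
- by move=> i; exact: fine_ge0.
- by move=> i; exact: fine_ge0.
- have UT : U [set: 'I_N.+1]%SET = setT.
    by rewrite -ccell; apply: eq_bigcupl; split => // i _ /=; rewrite inE.
  have sumT (c : 'I_N.+1 -> R) :
      (\sum_i c i = \sum_(i in [set: 'I_N.+1]%SET) c i)%R.
    by apply: eq_bigl => i; rewrite inE.
  by apply: EFin_inj; rewrite !sumT aS bS UT !probability_setT.
- move=> S; rewrite -lee_fin EFinD aS bS.
  (* the condition on [eps] is used for the part of [U S] in the balls *)
  have mB : measurable (U S `&` G N) by exact: measurableI.
  apply: (@le_trans _ _ (mu (U S `&` G N) + mu (~` G N))).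
    apply: le_trans (measureU2 _ _ _); [|exact: mB|exact: measurableC].
    apply: le_measure; rewrite ?inE//; first exact: measurableU (measurableC _).
    by move=> x Ux; have [|] := pselect (G N x); [left|right].
  apply: (le_trans (leeD (epsP _ mB) muN)).
  rewrite (_ : (eps + 2 * r)%R = (r + (eps + r))%R); last by lra.
  rewrite -addeA -EFinD [in leRHS]EFinD addeA; apply: leeD => //.
  apply: (@le_trans _ _ (nu (U (neighbours e S)) + nu (~` G N))); last first.
    exact: leeD.
  apply: le_trans (measureU2 _ _ _); [|exact: mU|exact: measurableC].
  apply: le_measure; rewrite ?inE; [exact: measurable_thickening| |].
    exact: measurableU (measurableC _).
  move=> y /thickeningP/(_ r r0)[x [[i /= iS ix] Gx] yx].
  have [Gy|] := pselect (G N y); [left|by right].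
  have [j _ jy] : (\bigcup_j cell j) y by rewrite ccell.
  exists j => //=; apply/neighboursP; exists i => //.
  rewrite /e (cellG i x)// (cellG j y)//=; apply/asboolP.
  by exists x, y; split=> //; rewrite metric_sym.
have [||P [Pmu Pnu Pw]] := @coupling_of_cells _ _ _ _ R mu nu _ _ cell cell
  mcell mcell tcell tcell ccell ccell w w0.
- by move=> i; rewrite wa -probability_fin.
- by move=> j; rewrite wb -probability_fin.
exists P; first by move=> A mA; split; [exact: Pmu|exact: Pnu].
pose bad (p : 'I_N.+1 * 'I_N.+1) := ~~ e p.1 p.2.
apply: (@le_trans _ _ (\sum_(p | bad p) P (cell p.1 `*` cell p.2))).
  rewrite sum_fsbig; apply: content_sub_fsum.
  - exact: finite_finpred.
  - by move=> p _; exact: measurableX.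
  - exact: measurable_far.
  move=> [x y]/= xy.
  have [i _ ix] : (\bigcup_i cell i) x by rewrite ccell.
  have [j _ jy] : (\bigcup_j cell j) y by rewrite ccell.
  exists (i, j) => //=.
  apply/negP => /and3P[iN jN /asboolP[x' [y' [ix' jy' x'y']]]].
  have := cellF _ _ iN ix; have := cellF _ _ iN ix'.
  have := cellF _ _ jN jy; have := cellF _ _ jN jy'.
  rewrite /F/= (metric_sym _ x) (metric_sym _ y') => *.
  have := metric_triangle x (s i) x'; have := metric_triangle y' (s j) y.
  have := metric_triangle x x' y; have := metric_triangle x' y' y.
  move: xy; rewrite /dist/=; lra.
rewrite (eq_bigr (fun p => (w p.1 p.2)%:E)); last by move=> p _; exact: Pw.
rewrite sumEFin lee_fin; apply: le_trans wbad.
by rewrite pair_big_dep.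
Qed.

Lemma expectation_le_far (P : probability (borel Omega * borel Omega)%type R)
    (K D : R) : separable Omega -> (0 <= K)%R -> (forall w, dist w <= D)%R ->
  'E_P[dist] <= K%:E + D%:E * P [set w | (K < dist w)%R].
Proof.
move=> sO K0 dD; set far := mkset _.
have mfar : measurable far := measurable_far K sO.
have D0 : (0 <= D)%R by apply: le_trans (dD point); exact: mdist_ge0.
rewrite unlock.
apply: (@le_trans _ _ (\int[P]_w (K%:E + D%:E * (\1_far w)%:E))).
  apply: ge0_le_integral => //=.
  - by move=> w _; rewrite lee_fin mdist_ge0.
  - by apply/measurable_EFinP; exact: measurable_mdist.
  - apply: emeasurable_funD => //; apply: emeasurable_funM => //.
    by apply/measurable_EFinP; exact: measurable_indic.
  - move=> w _; rewrite -EFinM -EFinD lee_fin indicE.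
    have [fw|fw] := boolP (w \in far).
      by rewrite mulr1 (le_trans (dD w))// lerDr.
    by move: fw; rewrite notin_setE/= mulr0 addr0 => /negP; rewrite -leNgt.
rewrite ge0_integralD//.
- rewrite integral_cst// [X in _ * X](_ : _ = 1) ?mule1; last first.
    exact: probability_setT.
  by rewrite ge0_integralZl ?integral_indic ?setIT//; exact/measurable_EFinP.
- by move=> w _; rewrite mule_ge0// lee_fin.
- apply: emeasurable_funM => //; apply/measurable_EFinP.
  exact: measurable_indic.
Qed.

Lemma wasserstein_le : separable Omega -> diam Omega < +oo ->
  wasserstein mu nu <= (diam Omega + 1) * prokhorov mu nu.
Proof.
move=> sO diam_fin.
have diam_ub w : (dist w)%:E <= diam Omega.
  by apply: ereal_sup_ubound; exists (w.1, w.2).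
have diam_ge0 : 0 <= diam Omega.
  by apply: le_trans (diam_ub point); rewrite lee_fin mdist_ge0.
have [D DE] : exists D, diam Omega = D%:E.
  by exists (fine (diam Omega)); rewrite fineK// ge0_fin_numE.
have dD w : (dist w <= D)%R by rewrite -lee_fin -DE.
have D0 : (0 <= D)%R by rewrite -lee_fin -DE.
rewrite DE; apply/lee_addgt0Pr => t t0.
have D1 : (0 < D + 1)%R by lra.
(* [strassen] is used with slack [r] for some admissible [eps] within [r] of
   the infimum, so the total error is at most [6 * r * (D + 1)] *)
pose r := (t / (6 * (D + 1)))%R.
have r0 : (0 < r)%R by rewrite divr_gt0// mulr_gt0.
have [eps heps epsp] : exists2 eps, prokhorov_radius mu nu eps &
    eps%:E < prokhorov mu nu + r%:E.
  have : prokhorov mu nu < prokhorov mu nu + r%:E.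
    by rewrite lteDl ?prokhorov_fin_num// lte_fin.
  by move=> /ereal_inf_lt[_ [eps heps <-] epsr]; exists eps.
have [P cP Pfar] := strassen sO heps r0.
apply: (@le_trans _ _ 'E_P[dist]); first by apply: ereal_inf_lbound; exists P.
have eps0 : (0 < eps)%R by case: heps.
apply: (le_trans (expectation_le_far P (K := eps + 5 * r) sO _ dD)).
  lra.
apply: (@le_trans _ _ ((eps + 5 * r) + D * (eps + 2 * r))%:E).
  by rewrite [leRHS]EFinD leeD2l// EFinM lee_wpmul2l// lee_fin.
move: epsp; rewrite -(fineK (prokhorov_fin_num mu nu)) -EFinD lte_fin => epsp.
rewrite -EFinD lee_fin; set p := fine _ in epsp *.
have tE : (t = (D + 1) * (6 * r))%R.
  by rewrite mulrA [((D + 1) * 6)%R]mulrC [RHS]mulrC divfK// mulf_neq0// gt_eqF.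
rewrite tE -mulrDr; apply: (@le_trans _ _ ((D + 1) * (eps + 5 * r))%R).
  have : (0 <= D * r)%R by rewrite mulr_ge0// ltW.
  lra.
rewrite ler_pM2l//; lra.
Qed.

End strassen.

(* When diam Omega = +oo the right-hand inequality is void. *)
Theorem theorem2 (R : realType) (Omega : pointedMetricType R)
    (sepOmega : separable Omega) (mu nu : probability (borel Omega) R) :
  (prokhorov mu nu) ^+ 2 <= wasserstein mu nu /\
  (diam Omega < +oo ->
   wasserstein mu nu <= (diam Omega + 1) * prokhorov mu nu).
Proof.
by split; [exact: sqr_prokhorov_le|exact: wasserstein_le].
Qed.
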